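(* Let $\varepsilon=-\tfrac{1}{15}$ and consider the planar piecewise smooth system $$\dot x = 1-x-k(y)\,x,\qquad \dot y=\beta-\beta\varepsilon-k(y)\,\varepsilon-\alpha-(\beta+k(y))\,y-(\alpha\beta-\alpha)\,x,$$ with $\alpha=\tfrac45$, $\beta=\tfrac12$, $k(y)=1$ for $y>0$ and $k(y)=0$ for $y<0$. Then, using Filippov dynamics on the splitting manifold $\{y=0\}$, all orbits which slide along the splitting manifold are homoclinic orbits (to the boundary equilibrium $(\tfrac12,0)$).
   Context: For $\lambda\in[0,1]$ write $f(x,y;\lambda)=\bigl(1-x-\lambda x,\ \beta-\beta\varepsilon-\lambda\varepsilon-\alpha-(\beta+\lambda)y-(\alpha\beta-\alpha)x\bigr)$ with $\alpha=4/5$, $\beta=1/2$; equivalently $f(x,y;\lambda)=\bigl(1-(1+\lambda)x,\ -\tfrac{3}{10}+\tfrac25 x-(\tfrac12+\lambda)(y+\varepsilon)\bigr)$. The system is $(\dot x,\dot y)=f(x,y;k(y))$ for $y\neq 0$. A Filippov solution is an absolutely continuous curve $\gamma(t)=(x(t),y(t))$ with $\dot\gamma(t)\in F(\gamma(t))$ for almost every $t$, where $F(x,y)=\{f(x,y;k(y))\}$ if $y\ne0$ and $F(x,0)=\{f(x,0;\lambda):\lambda\in[0,1]\}$. Filippov solutions need not be unique forward in time: a solution in an unstable sliding region may slide for an arbitrary length of time and then leave into $y>0$ or into $y<0$. The sliding region is the set of points $(x,0)$ for which the second component of $f(x,0;\lambda)$ vanishes for some $\lambda=\lambda^*(x)\in[0,1]$.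 At $\varepsilon=-1/15$ its interior is $\{(x,0): \tfrac12<x<\tfrac23\}$. While a solution remains in the sliding region it follows the sliding flow $\dot x=1-x-\lambda^*(x)\,x$. The boundary equilibrium is $p=(\tfrac12,0)$, the zero of $f(\cdot\,;1)$ at $\varepsilon=-1/15$. An orbit which slides along the splitting manifold is the orbit of a Filippov solution $\gamma:\mathbb{R}\to\mathbb{R}^2$ that lies in the interior of the sliding region during some time interval of positive length. A homoclinic orbit (to $p$) is the orbit of a nonconstant Filippov solution $\gamma:\mathbb{R}\to\mathbb{R}^2$ with $\gamma(t)\to p$ both as $t\to+\infty$ and as $t\to-\infty$. *)

(* Defs.v *)
From HB Require Import structures.
From mathcomp Require Import all_boot all_order all_algebra.
From mathcomp Require Import all_classical all_reals all_analysis.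
Set Implicit Arguments.
Unset Strict Implicit.
Unset Printing Implicit Defensive.
Import Order.TTheory GRing.Theory Num.Theory.
Import numFieldNormedType.Exports.
Local Open Scope classical_set_scope.
Local Open Scope ring_scope.

(* Absolute continuity on every compact interval `[a, b]; the intervals
   `]s i, t i[ may be empty (s i = t i). *)
Definition abs_continuous (R : realType) (V : normedModType R) (g : R -> V) :=
  forall a b e : R, 0 < e -> exists2 d : R, 0 < d &
    forall (n : nat) (s t : 'I_n -> R),
      (forall i, [/\ a <= s i, s i <= t i & t i <= b]) ->
      trivIset setT (fun i => `]s i, t i[%classic) ->
      \sum_(i < n) (t i - s i) < d ->
      \sum_(i < n) `|g (t i) - g (s i)| < e.

Definition filippov_solution (R : realType) (F : R * R -> set (R * R))
    (g : R -> R * R) :=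
  abs_continuous g /\
  {ae @lebesgue_measure R, forall t, derivable g t 1 /\ F (g t) (derive1 g t)}.

Definition homoclinic_orbit (R : realType) (F : R * R -> set (R * R))
    (p : R * R) (O : set (R * R)) :=
  exists g : R -> R * R,
    [/\ filippov_solution F g,
        (exists t t' : R, g t <> g t'),
        g t @[t --> +oo%R] --> p,
        g t @[t --> -oo%R] --> p &
        O = range g].

Definition pws_field (R : realType) (alpha beta eps : R) (z : R * R) (lam : R)
    : R * R :=
  (1 - z.1 - lam * z.1,
   beta - beta * eps - lam * eps - alpha - (beta + lam) * z.2
     - (alpha * beta - alpha) * z.1).

(* The value at y = 0 is never used. *)
Definition heaviside (R : realType) (y : R) : R := if 0 < y then 1 else 0.

Definition filippov_field (R : realType) (alpha beta eps : R) (z : R * R)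
    : set (R * R) :=
  if z.2 == 0 then [set pws_field alpha beta eps z lam | lam in `[0, 1]%classic]
  else [set pws_field alpha beta eps z (heaviside z.2)].

Definition sliding_region (R : realType) (alpha beta eps : R) : set (R * R) :=
  [set z | z.2 = 0 /\
     exists2 lam : R, 0 <= lam <= 1 & (pws_field alpha beta eps z lam).2 = 0].

(* The interior is taken relative to the line y = 0; as a subset of the plane
   the sliding region has empty interior. *)
Definition sliding_interior (R : realType) (alpha beta eps : R)
    : set (R * R) :=
  [set z | z.2 = 0 /\
     interior [set x : R | sliding_region alpha beta eps (x, 0)] z.1].

Definition sliding_orbit (R : realType) (alpha beta eps : R)
    (O : set (R * R)) :=
  exists g : R -> R * R,
    [/\ filippov_solution (filippov_field alpha beta eps) g,
        (exists a b : R, a < b /\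
           forall t, a < t < b -> sliding_interior alpha beta eps (g t)) &
        O = range g].

(* Main.v *)
Require Import Defs.
From mathcomp Require Import all_boot all_order all_algebra.
From mathcomp Require Import all_classical all_reals all_analysis.
From mathcomp Require Import ring lra.
Set Implicit Arguments.
Unset Strict Implicit.
Unset Printing Implicit Defensive.
Import Order.TTheory GRing.Theory Num.Theory.
Import numFieldNormedType.Exports.
Local Open Scope classical_set_scope.
Local Open Scope ring_scope.

(** The solution that slides is itself the homoclinic one: a Filippov solution
    [g] which is in the interior of the sliding region at one time [t0] tends to
    [(1 / 2, 0)] at both ends, whatever choices it makes when it leaves the
    region.

    Write [u = x - 1 / 2]. The interior of the sliding region is
    [0 < u < 1 / 6], [y = 0]. Forward in time [u] stays positive, and the
    solution cannot remain in [y <= 0] forever, because there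
    [w = u + 15 / 2 * y] satisfies [w' >= w] while [w <= u] is bounded
    ([eventually_above]). Once it is in [y > 0] with [u > 0] it stays there
    ([above_forward]), and the upper field is a linear sink whose equilibrium is
    [(1 / 2, 0)] ([above_decay]). Backward in time the sliding region attracts:
    the solution must have been sliding at all times before [t0]
    ([sliding_backward]), and along the sliding flow [u' >= u], so that [u]
    tends to [0] exponentially at minus infinity ([sliding_backward_decay]).

    The choice of [w] removes the multivaluedness of the field on the line:
    for [y <= 0] the unknown parameter disappears from the inequality
    [w' >= w]. Thus one never has to determine the sliding vector field, nor to
    know at which times the solution is on the line.

    The analytic tool is a Gronwall inequality for absolutely continuous
    functions whose derivative is controlled almost everywhere ([ae_gronwall]).
    It follows from the fact that such a function is nondecreasing when its
    derivative is nonnegative almost everywhere ([ae_derive_ge0_le]), proved by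
    a subdivision argument of Cousin type. *)

(** * Absolutely continuous functions: monotonicity and Gronwall *)

(** Cousin's lemma: the supremum of the points reachable from [a] by a finite
    chain is itself reachable, and cannot be less than [b]: a piece tagged by it
    starts at a reachable point on its left and ends on its right. For this the
    relation is asked of all the short intervals that contain [t]. *)
Lemma tagged_subdivision (R : realType) (L : R -> R -> Prop) (a b : R) :
  a <= b ->
  (forall t, a <= t <= b -> exists2 d, 0 < d &
     forall s r, t - d < s -> s <= t -> t <= r -> r < t + d -> L s r) ->
  exists n (x : nat -> R), [/\ x 0%N = a, x n = b &
    forall i, (i < n)%N -> x i <= x i.+1 /\ L (x i) (x i.+1)].
Proof.
move=> leab locL.
pose S c := exists n (x : nat -> R), [/\ x 0%N = a, x n = c &
    forall i, (i < n)%N -> x i <= x i.+1 /\ L (x i) (x i.+1)].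
pose E := [set c | a <= c <= b /\ S c].
have Ea : E a by split; [lra|exists 0%N, (fun=> a)].
have supE : has_sup E.
  by split; [exists a|exists b => c [/andP[]]].
have [c1 c2] : a <= sup E /\ sup E <= b.
  split; first exact: sup_upper_bound.
  by apply: ge_sup => [|c [/andP[]]//]; exists a.
have [|d d0 dL] := locL (sup E); first exact/andP.
have [t [/andP[at_ tb] [n [x [x0 xn xi]]]] dt] := sup_adherent d0 supE.
have tsup : t <= sup E.
  by apply: sup_upper_bound => //; split; [exact/andP|exists n, x].
pose r := Num.min b (sup E + d / 2).
have [rb rd] : r <= b /\ r <= sup E + d / 2.
  by rewrite /r; split; rewrite ge_min lexx ?orbT.
have supr : sup E <= r by rewrite /r le_min c2; lra.
have Sr : S r.
  exists n.+1, (fun i => if (i <= n)%N then x i else r); split => //.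
    by rewrite ltnn.
  move=> i; rewrite ltnS => lein; rewrite lein.
  case: ltnP => [/xi//|leni].
  have -> : i = n by apply/eqP; rewrite eqn_leq lein.
  rewrite xn; split; first lra.
  by apply: dL; lra.
have : r <= sup E by apply: sup_upper_bound => //; split=> //; lra.
case: (leP b (sup E + d / 2)) => hb rE; last first.
  by move: rE; rewrite /r; case: (leP b _) => ?; lra.
by suff -> : b = r by []; rewrite /r min_l.
Qed.

Lemma abs_continuous_continuous (R : realType) (V : normedModType R)
    (f : R -> V) : abs_continuous f -> continuous f.
Proof.
move=> acf t; apply/cvgrPdist_lt => e e0.
have [d d0 df] := acf (t - 1) (t + 1) e e0.
apply/nbhs_ballP; exists (Num.min d 1) => /=; first by rewrite lt_min d0 ltr01.
move=> s; rewrite /ball/= lt_min => /andP[tsd ts1].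
move: tsd ts1; rewrite !ltr_norml => /andP[? ?] /andP[? ?].
have small p q : t - 1 <= p -> p <= q -> q <= t + 1 -> q - p < d ->
    `|f q - f p| < e.
  move=> ? ? ? ?; have := df 1%N (fun=> p) (fun=> q); rewrite !big_ord1.
  by apply => // i j _ _ _; rewrite !ord1.
by case: (leP s t) => st; [|rewrite distrC]; apply: small; lra.
Qed.

(** The two ends are compared with [h t] separately, which gives a bound in
    terms of the whole length [r - s]: this is why the tag of a piece is kept
    inside it. *)
Lemma derive_ge0_straddle (R : realType) (h : R -> R) (t eps : R) :
  derivable h t 1 -> 0 <= h^`()%classic t -> 0 < eps ->
  exists2 d, 0 < d & forall s r, t - d < s -> s <= t -> t <= r -> r < t + d ->
    h s - eps * (r - s) <= h r.
Proof.
move=> dh h0 eps0.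
have : (fun k => k^-1 *: (h (k + t) - h t)) @ 0^' --> h^`()%classic t.
  rewrite derive1E; have := dh; rewrite /derivable /derive.
  rewrite (_ : (fun k => k^-1 *: ((h \o shift t) (k *: 1) - h t)) =
    (fun k => k^-1 *: (h (k + t) - h t))) //.
  by apply/funext => k; rewrite /= /shift /= scaler1.
move=> /cvgrPdist_lt /(_ eps eps0) /nbhs_ballP [d /= d0 hd].
exists d => // s r ds st tr rd.
have key k : `|k| < d -> k != 0 -> - eps < k^-1 * (h (k + t) - h t).
  move=> kd k0; have := hd k; rewrite /ball/= sub0r normrN.
  move=> /(_ kd k0); rewrite ltr_norml => /andP[_].
  by rewrite /GRing.scale/=; lra.
have hr : h t - eps * (r - t) <= h r.
  have [->|rt] := eqVneq r t; first lra.
  have := key (r - t); rewrite subrK subr_eq0 rt ger0_norm; last lra.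
  by rewrite ltr_pdivlMl; [move=> /(_ _ isT); lra|rewrite subr_gt0 lt_def rt].
have hs : h s - eps * (t - s) <= h t.
  have [->|sneqt] := eqVneq s t; first lra.
  have := key (s - t); rewrite subrK subr_eq0 sneqt ler0_norm; last lra.
  rewrite ltr_ndivlMl; last by rewrite subr_lt0 lt_def eq_sym sneqt.
  by move=> /(_ _ isT); lra.
lra.
Qed.

Lemma subdivision_trivIset (R : realType) (n : nat) (x t : nat -> R) :
  (forall i, (i < n)%N -> x i <= x i.+1) ->
  (forall i, (i < n)%N -> t i <= x i.+1) ->
  trivIset setT (fun i : 'I_n => `]x i, t i[%classic).
Proof.
move=> xi ti.
have xle j : (j <= n)%N -> forall i, (i <= j)%N -> x i <= x j.
  elim: j => [_ i|j IH jn i]; first by rewrite leqn0 => /eqP->.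
  rewrite leq_eqVlt => /predU1P[->//|]; rewrite ltnS => ij.
  by rewrite (le_trans (IH (ltnW jn) i ij))// xi.
have disj (i j : 'I_n) : (i < j)%N -> `]x i, t i[ `&` `]x j, t j[ = set0.
  move=> ij; rewrite -subset0 => z /= [].
  rewrite !in_itv/= => /andP[_ zi] /andP[jz _].
  have := xle j (ltnW (ltn_ord j)) i.+1 ij; have := ti i (ltn_ord i); lra.
apply/trivIsetP => i j _ _; rewrite neq_ltn => /orP[|] ij; first exact: disj.
by rewrite setIC; exact: disj.
Qed.

Lemma sum_length_le_measure (R : realType) (n : nat) (s t : 'I_n -> R)
    (U : set R) :
  (forall i, s i <= t i) -> trivIset setT (fun i => `]s i, t i[%classic) ->
  open U -> (forall i, `]s i, t i[%classic `<=` U) ->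
  ((\sum_(i < n) (t i - s i))%:E <= lebesgue_measure U)%E.
Proof.
move=> st tI oU stU.
have -> : (\sum_(i < n) (t i - s i))%:E =
    lebesgue_measure (\big[setU/set0]_(i < n) `]s i, t i[%classic).
  rewrite measure_bigsetU_ord//= -sumEFin; apply: eq_bigr => i _.
  rewrite lebesgue_measure_itv/= lte_fin; case: ltP => // ts.
  by congr (_%:E); have := st i; lra.
apply: le_measure; rewrite ?inE.
- exact: bigsetU_measurable.
- exact: measurable_realfun.open_measurable.
- by apply: (big_ind (fun A => A `<=` U)) => // A B AU BU; rewrite subUset.
Qed.

(** The exceptional null set, enlarged by the two end points, is covered by an
    open set [U] of measure less than the [d] given by absolute continuity. In a
    fine enough subdivision each piece either lies in [U], and the variation of
    [h] over all such pieces is small, or is tagged by a point where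
    [0 <= h'], and on it [h] decreases at most by a small multiple of the
    length. Summing over the pieces bounds [h a - h b] by an arbitrary
    positive number. *)
Lemma ae_derive_ge0_le (R : realType) (h : R -> R) (a b : R) :
  a <= b -> abs_continuous h ->
  {ae @lebesgue_measure R, forall t, a < t < b ->
    derivable h t 1 /\ 0 <= h^`()%classic t} ->
  h a <= h b.
Proof.
move=> leab ach aeh.
apply/ler_addgt0Pr => e0 e0_gt0.
pose e := e0 / 2; pose eps := e / (b - a + 1).
have e_gt0 : 0 < e by rewrite divr_gt0.
have eps_gt0 : 0 < eps by rewrite divr_gt0//; lra.
have [d d_gt0 hd] := ach a b e e_gt0.
pose N := ~` [set t | a < t < b -> derivable h t 1 /\ 0 <= h^`()%classic t]
  `|` ([set a] `|` [set b]).
have /negligible_outer_measure N0 : lebesgue_measure.-negligible N.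
  apply: negligibleU => //.
  by apply: negligibleU; apply/negligibleP => //; exact: lebesgue_measure_set1.
have [U [oU NU Ud]] : exists U : set R,
    [/\ open U, N `<=` U & (lebesgue_measure U < d%:E)%E].
  have [|U [oU NU]] := outer_measure_open_le N (e := d / 2).
    by rewrite divr_gt0.
  rewrite N0 add0e => Ud; exists U; split => //.
  by rewrite (le_lt_trans Ud)// lte_fin; lra.
pose L s r := [set` `[s, r]] `<=` U \/ h s - eps * (r - s) <= h r.
have [|n [x [x0 xn xL]]] := @tagged_subdivision R L a b leab.
  move=> t tab; have [Ut|nUt] := pselect (U t).
    have /nbhs_ballP[k /= k0 kU] : nbhs t U by apply: open_nbhs_nbhs.
    exists k => // s r ? ? ? ?; left => z /=; rewrite in_itv/= => /andP[? ?].
    by apply: kU; rewrite /ball/= ltr_norml; apply/andP; split; lra.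
  have nNt : ~ N t by move=> /NU.
  have tab' : a < t < b.
    case/andP: tab => at_ tb; rewrite !lt_def at_ tb !andbT.
    by apply/andP; split; apply/eqP => tE; apply: nNt; right; rewrite tE;
      [left|right].
  have /contrapT /(_ tab') [dh h0] : ~ ~ (a < t < b ->
      derivable h t 1 /\ 0 <= h^`()%classic t) by move=> nt; apply: nNt; left.
  have [k k0 hk] := derive_ge0_straddle dh h0 eps_gt0.
  by exists k => // s r ? ? ? ?; right; exact: hk.
(* A piece that is not contained in U is replaced by an empty interval, so that
   one family of intervals serves for absolute continuity and for the sum. *)
pose t i := if `[< [set` `[x i, x i.+1]] `<=` U >] then x i.+1 else x i.
have xt i : (i < n)%N -> x i <= t i <= x i.+1.
  by move=> /xL[xi _]; rewrite /t; case: ifP => _; rewrite xi lexx.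
have tI : trivIset setT (fun i : 'I_n => `]x i, t i[%classic).
  by apply: subdivision_trivIset => i /[dup] /xL[? _] /xt/andP[].
have xab j : (j <= n)%N -> a <= x j.
  elim: j => [|j IH] jn; first by rewrite x0.
  by rewrite (le_trans (IH (ltnW jn)))//; have [] := xL j jn.
have xbb k : (k <= n)%N -> x (n - k)%N <= b.
  elim: k => [|k IH] kn; first by rewrite subn0 xn.
  rewrite (le_trans _ (IH (ltnW kn)))//.
  have /xL[+ _] : (n - k.+1 < n)%N by rewrite ltn_subrL (leq_trans _ kn).
  by rewrite subnSK.
have : \sum_(i < n) `|h (t i) - h (x i)| < e.
  apply: hd => //.
    move=> i; have /andP[xi ti] := xt i (ltn_ord i).
    split => //; first by apply: xab; exact: ltnW.
    rewrite (le_trans ti)//; have := xbb (n - i.+1)%N (leq_subr _ _).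
    by rewrite subKn.
  rewrite -lte_fin (le_lt_trans _ Ud)//; apply: sum_length_le_measure => //.
    by move=> i; have /andP[] := xt i (ltn_ord i).
  move=> i z /=; rewrite in_itv/= /t; case: ifPn => [/asboolP xU|_] /andP[? ?].
    by apply: xU; rewrite /= in_itv/=; apply/andP; split; lra.
  lra.
have telescope m : (m <= n)%N ->
    h a - \sum_(i < m) `|h (t i) - h (x i)| - eps * (x m - a) <= h (x m).
  elim: m => [_|m IH mn]; first by rewrite big_ord0 x0; lra.
  rewrite big_ord_recr/=; have := IH (ltnW mn).
  have [xm Lm] := xL m mn.
  have : h (x m) - `|h (t m) - h (x m)| - eps * (x m.+1 - x m) <= h (x m.+1).
    rewrite /t; case: ifPn => [_|/asboolPn nU].
      have := ler_norm (h (x m) - h (x m.+1)); rewrite distrC.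
      have : 0 <= eps * (x m.+1 - x m) by rewrite mulr_ge0 ?subr_ge0// ltW.
      lra.
    by case: Lm => // ?; rewrite subrr normr0; lra.
  lra.
have := telescope n (leqnn n); rewrite xn.
have : eps * (b - a) <= e.
  rewrite /eps mulrAC ler_pdivrMr; last lra.
  by rewrite ler_pM2l//; lra.
rewrite /e; lra.
Qed.

(** This is how every scalar function used below inherits absolute continuity
    from the solution: coordinates, affine combinations and products with
    exponentials. The term [t - s] allows for an explicit dependence on
    time. *)
Lemma abs_continuous_dominated (R : realType) (V W : normedModType R)
    (f : R -> V) (h : R -> W) :
  (forall a b, exists K, forall s t, a <= s -> s <= t -> t <= b ->
     `|h t - h s| <= K * (`|f t - f s| + (t - s))) ->
  abs_continuous f -> abs_continuous h.
Proof.
move=> dom acf a b e e0.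
have [K hK] := dom a b.
pose M := `|K| + 1.
have M0 : 0 < M by rewrite ltr_wpDl.
have e2 : 0 < e / (2 * M) by rewrite divr_gt0// mulr_gt0.
have [d d0 hd] := acf a b _ e2.
exists (Num.min d (e / (2 * M))); first by rewrite lt_min d0.
move=> n s t st tI; rewrite lt_min => /andP[sd se].
have le1 : \sum_(i < n) `|h (t i) - h (s i)| <=
    M * (\sum_(i < n) `|f (t i) - f (s i)| + \sum_(i < n) (t i - s i)).
  rewrite -big_split/= mulr_sumr; apply: ler_sum => i _.
  have [? ? ?] := st i.
  apply: (le_trans (hK _ _ _ _ _)) => //.
  apply: ler_wpM2r; first by rewrite addr_ge0// subr_ge0.
  by rewrite (le_trans (ler_norm K))// /M lerDl.
apply: (le_lt_trans le1).
have -> : e = M * (e / (2 * M) + e / (2 * M)) by field; rewrite gt_eqF.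
by rewrite ltr_pM2l// ltrD//; exact: hd.
Qed.

Lemma expR_lipschitz (R : realType) (C a b : R) :
  exists2 K, 0 <= K & forall s t, a <= s -> s <= t -> t <= b ->
    `|expR (C * t) - expR (C * s)| <= K * (t - s).
Proof.
(* The tangent line of the exponential at y lies below its graph. *)
have slope (x y : R) : expR y - expR x <= expR y * (y - x).
  have := expR_ge1Dx (x - y); rewrite expRD expRN => h.
  have y0 := expR_gt0 y.
  have : expR y * (1 + (x - y)) <= expR y * (expR x / expR y).
    by rewrite ler_pM2l.
  rewrite [X in _ <= X]mulrCA divff ?gt_eqF// mulr1; lra.
pose E := expR (`|C| * (`|a| + `|b|)).
exists (E * `|C|) => [|s t as_ st tb]; first by rewrite mulr_ge0 ?expR_ge0.
have bound r : a <= r -> r <= b -> expR (C * r) <= E.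
  move=> ar rb; rewrite ler_expR (le_trans (ler_norm _))// normrM.
  rewrite ler_wpM2l// ler_norml.
  have := ler_norm b; have := ler_norm (- a); rewrite normrN.
  have := normr_ge0 a; have := normr_ge0 b; lra.
have mono (x y : R) : expR y <= E -> expR y * (y - x) <= E * `|y - x|.
  move=> yE; rewrite (le_trans (ler_norm _))// normrM.
  by rewrite ler_wpM2r// ger0_norm ?expR_ge0.
have -> : E * `|C| * (t - s) = E * `|C * t - C * s|.
  by rewrite -mulrBr normrM [ `|t - s|]ger0_norm ?subr_ge0// mulrA.
rewrite ler_norml; apply/andP; split.
  have := le_trans (slope (C * t) (C * s)) (mono _ _ (bound s as_ _)).
  rewrite distrC => /(_ (le_trans st tb)); lra.
by have := le_trans (slope (C * s) (C * t)) (mono _ _ (bound t _ tb));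
  apply; exact: le_trans st.
Qed.

Lemma continuous_segment_bounded (R : realType) (f : R -> R) (a b : R) :
  continuous f -> exists2 M, 0 <= M & forall t, a <= t -> t <= b -> `|f t| <= M.
Proof.
move=> cf; have [ab|ba] := leP a b; last by exists 0 => // t ? ?; lra.
have [|c _ hc] := @EVT_max R (fun t => `|f t|) a b ab.
  apply: continuous_subspaceT => t.
  by apply: continuous_comp; [exact: cf|exact: norm_continuous].
by exists `|f c| => // t ? ?; apply: hc; rewrite in_itv/=; apply/andP.
Qed.

Lemma abs_continuous_expRM (R : realType) (phi : R -> R) (C : R) :
  abs_continuous phi -> abs_continuous (fun t => expR (C * t) * phi t).
Proof.
move=> acphi; apply: (abs_continuous_dominated _ acphi) => a b.
have [K K0 hK] := expR_lipschitz C a b.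
have [M M0 hM] := continuous_segment_bounded a b
  (abs_continuous_continuous acphi).
have [E E0 hE] := continuous_segment_bounded (f := fun t => expR (C * t)) a b
  ltac:(by move=> t; apply: continuous_comp;
    [exact: mulrl_continuous|exact: continuous_expR]).
exists (E + K * M) => s t as_ st tb.
have -> : expR (C * t) * phi t - expR (C * s) * phi s =
    expR (C * t) * (phi t - phi s) + (expR (C * t) - expR (C * s)) * phi s.
  by ring.
rewrite (le_trans (ler_normD _ _))// !normrM.
have h1 : `|expR (C * t)| * `|phi t - phi s| <= E * `|phi t - phi s|.
  by rewrite ler_wpM2r// hE// (le_trans as_).
have h2 : `|expR (C * t) - expR (C * s)| * `|phi s| <= K * (t - s) * M.
  by rewrite ler_pM// ?hK// hM// (le_trans st).
have h3 : 0 <= E * (t - s) by rewrite mulr_ge0// subr_ge0.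
have h4 : 0 <= K * M * `|phi t - phi s| by rewrite !mulr_ge0.
lra.
Qed.

(** The product of [phi] with the integrating factor [expR (C * t)] has a
    nonnegative derivative almost everywhere. Since [C] may have any sign, the
    lemma bounds both growth and decay from below, and from above when it is
    applied to [- phi]. *)
Lemma ae_gronwall (R : realType) (phi : R -> R) (C a b : R) :
  a <= b -> abs_continuous phi ->
  {ae @lebesgue_measure R, forall t, a < t < b ->
    derivable phi t 1 /\ - C * phi t <= phi^`()%classic t} ->
  phi a * expR (- C * (b - a)) <= phi b.
Proof.
move=> ab acphi aephi.
have : expR (C * a) * phi a <= expR (C * b) * phi b.
  apply: (@ae_derive_ge0_le _ (fun t => expR (C * t) * phi t) a b ab).
    exact: abs_continuous_expRM.
  have F := @ae_filter_ringOfSetsType _ _ _ (@lebesgue_measure R).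
  move: aephi; apply: filterS => t ht tab; have {ht} [dphi phit] := ht tab.
  have dt : is_derive t 1 phi (phi^`()%classic t).
    by rewrite derive1E; exact/derivableP.
  have de : is_derive t 1 (fun t => expR (C * t)) (expR (C * t) * C).
    apply: (@is_derive1_comp _ expR (fun t => C * t)).
    have := is_deriveZ C (is_derive_id t (1 : R)).
    by rewrite /GRing.scale/= mulr1.
  have dm := is_deriveM de dt.
  split; first exact: ex_derive.
  rewrite derive1E derive_val /GRing.scale/=.
  have : 0 <= expR (C * t) * (phi^`()%classic t + C * phi t).
    by rewrite mulr_ge0 ?expR_ge0//; lra.
  lra.
have -> : - C * (b - a) = C * a - C * b by ring.
rewrite expRD expRN mulrA ler_pdivrMr ?expR_gt0//; lra.
Qed.

(** * The affine observables of a Filippov solution *)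

Lemma is_derive_pair (R : realType) (g : R -> R * R) (t : R) :
  derivable g t 1 ->
  is_derive t 1 (fun s => (g s).1) (g^`()%classic t).1 /\
  is_derive t 1 (fun s => (g s).2) (g^`()%classic t).2.
Proof.
move=> dg; rewrite derive1E.
have dg' : (fun h => h^-1 *: ((g \o shift t) (h *: 1) - g t)) @ 0^' -->
  'D_1 g t := dg.
split.
- have c1 : (fun h => h^-1 *: (((fun s => (g s).1) \o shift t) (h *: 1) -
      (g t).1)) @ 0^' --> ('D_1 g t).1.
    exact: (cvg_comp _ _ dg' (@cvg_fst _ _ _ _ _)).
  by split; [exact: cvgP c1|exact: cvg_lim c1].
- have c2 : (fun h => h^-1 *: (((fun s => (g s).2) \o shift t) (h *: 1) -
      (g t).2)) @ 0^' --> ('D_1 g t).2.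
    exact: (cvg_comp _ _ dg' (@cvg_snd _ _ _ _ _)).
  by split; [exact: cvgP c2|exact: cvg_lim c2].
Qed.

Definition splitting_solution (R : realType) (g : R -> R * R) : Prop :=
  filippov_solution (filippov_field (4 / 5) (1 / 2) (- (1 / 15))) g.

(** The abscissa is measured from the boundary equilibrium [(1 / 2, 0)]. *)
Definition observable (R : realType) (g : R -> R * R) (p q r t : R) : R :=
  p * ((g t).1 - 1 / 2) + q * (g t).2 + r.

Lemma abs_continuous_observable (R : realType) (g : R -> R * R) (p q r : R) :
  abs_continuous g -> abs_continuous (observable g p q r).
Proof.
apply: abs_continuous_dominated => a b; exists (`|p| + `|q|) => s t _ st _.
have -> : observable g p q r t - observable g p q r s =
  p * (g t - g s).1 + q * (g t - g s).2 by rewrite /observable/=; ring.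
rewrite (le_trans (ler_normD _ _))// !normrM [leRHS]mulrDl.
have n1 : `|(g t - g s).1| <= `|g t - g s|.
  by rewrite [leRHS]prod_normE le_max lexx.
have n2 : `|(g t - g s).2| <= `|g t - g s|.
  by rewrite [leRHS]prod_normE le_max lexx orbT.
by rewrite lerD// ler_wpM2l// ler_wpDr// subr_ge0.
Qed.

(** All that is used of the differential inclusion. The parameter [m] is
    [1 - lambda]: it is free in [0, 1] on the splitting line, [0] above and [1]
    below. With [u = x - 1 / 2] the field reads
    [u' = m / 2 - (2 - m) * u] and
    [y' = 2 / 5 * u - m / 15 - (3 / 2 - m) * y], so a differential inequality
    for a combination of [u] and [y] becomes a polynomial inequality in [u], [y]
    and [m]. *)
Lemma observable_gronwall (R : realType) (g : R -> R * R) (p q r C a b : R) :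
  splitting_solution g ->
  a <= b ->
  (forall t m, a < t < b -> 0 <= m <= 1 ->
     (0 < (g t).2 -> m = 0) -> ((g t).2 < 0 -> m = 1) ->
     - C * observable g p q r t <=
     p * (m / 2 - (2 - m) * ((g t).1 - 1 / 2)) +
     q * (2 / 5 * ((g t).1 - 1 / 2) - m / 15 - (3 / 2 - m) * (g t).2)) ->
  observable g p q r a * expR (- C * (b - a)) <= observable g p q r b.
Proof.
move=> [acg aeg] ab hineq; apply: ae_gronwall => //.
  exact: abs_continuous_observable.
have F := @ae_filter_ringOfSetsType _ _ _ (@lebesgue_measure R).
move: aeg; apply: filterS => t [/is_derive_pair[d1 d2] gt] tab.
have dobs : is_derive t 1 (observable g p q r)
    (p * (g^`()%classic t).1 + q * (g^`()%classic t).2).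
  have d3 := is_deriveZ p (is_deriveB d1 (is_derive_cst (1 / 2 : R) t (1 : R))).
  have := is_deriveD (is_deriveD d3 (is_deriveZ q d2)) (is_derive_cst r t 1).
  by rewrite subr0 addr0.
split; first exact: ex_derive.
rewrite derive1E derive_val.
have [m [m01 mpos mneg ->]] : exists m, [/\ 0 <= m <= 1,
    0 < (g t).2 -> m = 0, (g t).2 < 0 -> m = 1 &
    g^`()%classic t = pws_field (4 / 5) (1 / 2) (- (1 / 15)) (g t) (1 - m)].
  move: gt; rewrite /filippov_field; case: eqP => [-> [lam]|_ /= ->].
    rewrite /= in_itv/= => /andP[? ?] <-; exists (1 - lam).
    by split; [apply/andP; split; lra|lra|lra|rewrite subKr].
  exists (1 - heaviside (g t).2); rewrite subKr /heaviside.
  by split; [apply/andP; split|..|by []]; case: (ltP 0) => // *; lra.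
apply: (le_trans (hineq _ _ tab m01 mpos mneg)).
by rewrite /pws_field/= le_eqVlt; apply/orP; left; apply/eqP; field.
Qed.

Lemma continuous_observable (R : realType) (g : R -> R * R) (p q r : R) :
  splitting_solution g -> continuous (observable g p q r).
Proof.
case=> acg _; apply: abs_continuous_continuous.
exact: abs_continuous_observable.
Qed.

(** Continuous induction: at the infimum of the times where [phi] is not
    positive, the hypothesis says that [phi] is positive, hence it is so on a
    neighbourhood. Gronwall bounds that only hold while [phi] is positive can
    then be used to propagate positivity. *)
Lemma positivity_persists (R : realType) (phi : R -> R) (t0 : R) :
  continuous phi -> 0 < phi t0 ->
  (forall t, t0 < t -> (forall s, t0 <= s < t -> 0 < phi s) -> 0 < phi t) ->
  forall t, t0 <= t -> 0 < phi t.
Proof.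
move=> cphi phi0 step t t0t; rewrite ltNge; apply/negP => phit.
pose E := [set s | t0 <= s /\ phi s <= 0].
have infE : has_inf E by split; [exists t|exists t0 => s []].
have lb s : E s -> inf E <= s by move=> ?; apply: ge_inf => //; case: infE.
have t0inf : t0 <= inf E by apply: lb_le_inf => [|s []//]; exists t.
have pos : 0 < phi (inf E).
  have [<-//|neq] := eqVneq t0 (inf E).
  apply: step => [|s /andP[t0s sinf]]; first by rewrite lt_neqAle neq.
  by rewrite ltNge; apply/negP => phis; have := lb s (conj t0s phis); lra.
have /nbhs_ballP[d /= d0 hd] : nbhs (inf E) [set s | 0 < phi s].
  by apply: (cvgr_gt _ (cphi (inf E))).
have [s [t0s phis] sd] := inf_adherent d0 infE.
have : 0 < phi s.
  apply: hd; rewrite /ball/= ltr_norml; have := lb s (conj t0s phis).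
  by move=> ?; apply/andP; split; lra.
lra.
Qed.

(** * Forward in time *)

(** While [u > 0] one has [u' = m / 2 - (2 - m) * u >= - 2 * u]. *)
Lemma right_of_equilibrium_forward (R : realType) (g : R -> R * R) (t0 t : R) :
  splitting_solution g -> 1 / 2 < (g t0).1 -> t0 <= t -> 1 / 2 < (g t).1.
Proof.
move=> sg u0 t0t.
have uE s : observable g 1 0 0 s = (g s).1 - 1 / 2 by rewrite /observable; ring.
suff : 0 < observable g 1 0 0 t by rewrite uE; lra.
apply: (positivity_persists _ _ _ t0t).
- exact: continuous_observable.
- by rewrite uE; lra.
move=> r t0r upos.
apply: (lt_le_trans _ (observable_gronwall (C := 2) sg (ltW t0r) _)).
  by rewrite mulr_gt0 ?expR_gt0// uE; lra.
move=> s m /andP[t0s sr] /andP[m0 m1] _ _.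
have := upos s; rewrite uE (ltW t0s) sr => /(_ isT); nra.
Qed.

(** Above the line [y' = 2 / 5 * u - 3 / 2 * y], so that [y' >= - 3 / 2 * y]
    as long as [u > 0]. *)
Lemma above_forward (R : realType) (g : R -> R * R) (t0 t : R) :
  splitting_solution g -> 1 / 2 < (g t0).1 -> 0 < (g t0).2 -> t0 <= t ->
  0 < (g t).2.
Proof.
move=> sg u0 y0 t0t.
have yE s : observable g 0 1 0 s = (g s).2 by rewrite /observable; ring.
rewrite -yE; apply: (positivity_persists _ _ _ t0t).
- exact: continuous_observable.
- by rewrite yE.
move=> r t0r ypos.
apply: (lt_le_trans _ (observable_gronwall (C := 3 / 2) sg (ltW t0r) _)).
  by rewrite mulr_gt0 ?expR_gt0// yE.
move=> s m /andP[t0s sr] _ m0 _.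
have u_gt := right_of_equilibrium_forward sg u0 (ltW t0s).
have := ypos s; rewrite !yE (ltW t0s) sr => /(_ isT) /m0 ->; lra.
Qed.

(** The combination [w = u + 15 / 2 * y] eliminates the unknown rate [m]: for
    [y <= 0] one has [m * y = y], on the line as well as below it, and the
    constant terms [m / 2] and [- m / 15] cancel, which leaves
    [w' = (1 + m) * u - 15 / 4 * y], and this is at least [w] for [u > 0]. On
    the line [w] is [u]. *)
Lemma below_gronwall (R : realType) (g : R -> R * R) (a b : R) :
  splitting_solution g -> a <= b ->
  (forall t, a < t < b -> 1 / 2 < (g t).1 /\ (g t).2 <= 0) ->
  observable g 1 (15 / 2) 0 a * expR (b - a) <= observable g 1 (15 / 2) 0 b.
Proof.
move=> sg ab hab; have := @observable_gronwall R g 1 (15 / 2) 0 (- 1) a b sg ab.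
rewrite opprK !mul1r; apply => t m tab /andP[m0 m1] _ mneg.
have [u_gt y_le] := hab t tab.
rewrite /observable; case: (ltgtP (g t).2 0) => [y_lt|y_gt|->]; [|lra|].
  by rewrite mneg//; lra.
nra.
Qed.

(** If [y] stayed nonpositive, [w = u + 15 / 2 * y <= u] would grow at least
    linearly, whereas [u' <= 1 / 2 - u] bounds [u]. The argument covers at once
    the solutions that leave the sliding region downwards, that slide up to the
    fold at [x = 2 / 3], or that slide before doing either. *)
Lemma eventually_above (R : realType) (g : R -> R * R) (t0 : R) :
  splitting_solution g -> 1 / 2 < (g t0).1 -> (g t0).2 = 0 ->
  exists2 t1, t0 <= t1 & 0 < (g t1).2.
Proof.
move=> sg u0 y0; apply: contrapT => noabove.
have u_gt t : t0 <= t -> 1 / 2 < (g t).1.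
  exact: right_of_equilibrium_forward.
have y_le t : t0 <= t -> (g t).2 <= 0.
  by move=> t0t; rewrite leNgt; apply/negP => yt; apply: noabove; exists t.
pose c := (g t0).1 - 1 / 2.
have c0 : 0 < c by rewrite /c; lra.
(* At this time the linear lower bound of w is c + 1, above the bound
   c + 1 / 2 of u. *)
pose t := t0 + c^-1.
have t0t : t0 <= t by rewrite /t lerDl invr_ge0 ltW.
have lower : c * expR (t - t0) <= observable g 1 (15 / 2) 0 t.
  have <- : observable g 1 (15 / 2) 0 t0 = c by rewrite /observable y0 /c; ring.
  apply: below_gronwall => // s /andP[t0s _].
  by split; [exact: u_gt (ltW _)|exact: y_le (ltW _)].
have upper : (g t).1 - 1 / 2 <= c + 1 / 2.
  have gr : observable g (- 1) 0 (c + 1 / 2) t0 * expR (- 1 * (t - t0)) <=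
      observable g (- 1) 0 (c + 1 / 2) t.
    apply: observable_gronwall => // s m /andP[t0s _] /andP[m0 m1] _ _.
    by rewrite /observable; have := u_gt s (ltW t0s); nra.
  suff /le_trans/(_ gr) : 0 <= observable g (- 1) 0 (c + 1 / 2) t0 *
      expR (- 1 * (t - t0)) by rewrite /observable; lra.
  by rewrite mulr_ge0 ?expR_ge0// /observable /c; lra.
have : c * (1 + (t - t0)) <= c * expR (t - t0).
  by rewrite ler_pM2l// expR_ge1Dx.
have := y_le t t0t.
have -> : c * (1 + (t - t0)) = c + 1.
  by rewrite /t; field; rewrite gt_eqF.
by move: lower; rewrite /observable; lra.
Qed.

(** In the upper half-plane the field is linear with eigenvalues [- 2] and
    [- 3 / 2], and [4 / 5 * u + y] is a left eigenvector for [- 3 / 2]. As [u]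
    and [y] are positive, it controls both. *)
Lemma above_decay (R : realType) (g : R -> R * R) (t1 t : R) :
  splitting_solution g -> 1 / 2 < (g t1).1 -> 0 < (g t1).2 -> t1 <= t ->
  observable g (4 / 5) 1 0 t <=
  observable g (4 / 5) 1 0 t1 * expR (- (3 / 2 * (t - t1))).
Proof.
move=> sg u1 y1 t1t.
suff : observable g (- (4 / 5)) (- 1) 0 t1 * expR (- (3 / 2) * (t - t1)) <=
    observable g (- (4 / 5)) (- 1) 0 t.
  have E s : observable g (- (4 / 5)) (- 1) 0 s = - observable g (4 / 5) 1 0 s.
    by rewrite /observable; ring.
  by rewrite !E mulNr lerN2 mulNr.
apply: observable_gronwall => // s m /andP[t1s _] _ m0 _.
rewrite m0; last exact: above_forward (ltW t1s).
by rewrite /observable; lra.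
Qed.

(** * Backward in time *)

(** The sliding region repels. An earlier point above the line would stay above
    it until [t0]. So [y <= 0] throughout, hence [w = u + 15 / 2 * y] is at most
    [w (t0) = u (t0) < 1 / 6]. Below the line this bound turns into
    [(- y)' >= - 7 / 2 * (- y)], so an earlier point below the line would stay
    below it until [t0]. *)
Lemma slides_while_right_of_equilibrium (R : realType) (g : R -> R * R)
    (s t0 : R) :
  splitting_solution g -> (g t0).2 = 0 -> (g t0).1 < 2 / 3 -> s <= t0 ->
  (forall r, s <= r <= t0 -> 1 / 2 < (g r).1) -> (g s).2 = 0.
Proof.
move=> sg y0 u0 st0 u_gt.
have y_le r : s <= r <= t0 -> (g r).2 <= 0.
  move=> /[dup] srt /andP[sr rt0]; rewrite leNgt; apply/negP => y_gt.
  by have := above_forward sg (u_gt r srt) y_gt rt0; rewrite y0 ltxx.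
apply/eqP; rewrite eq_le y_le ?lexx//= leNgt; apply/negP => y_lt.
have w_le r : s <= r <= t0 ->
    observable g 1 (15 / 2) 0 r <= (g t0).1 - 1 / 2.
  move=> /andP[sr rt0].
  have u0gt : 1 / 2 < (g t0).1 by apply: u_gt; rewrite st0 lexx.
  have : observable g 1 (15 / 2) 0 r * expR (t0 - r) <=
      observable g 1 (15 / 2) 0 t0.
    apply: below_gronwall => // q /andP[rq qt0].
    have sqt : s <= q <= t0 by apply/andP; split; lra.
    by split; [exact: u_gt|exact: y_le].
  have -> : observable g 1 (15 / 2) 0 t0 = (g t0).1 - 1 / 2.
    by rewrite /observable y0; ring.
  have [w0|w0] := leP 0 (observable g 1 (15 / 2) 0 r); last lra.
  by apply: le_trans; rewrite ler_peMr// -expR0 ler_expR; lra.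
have vE r : observable g 0 (- 1) 0 r = - (g r).2 by rewrite /observable; ring.
have : 0 < observable g 0 (- 1) 0 t0.
  apply: (positivity_persists _ _ _ st0).
  - exact: continuous_observable.
  - by rewrite vE; lra.
  move=> r sr vpos; have [rt0|t0r] := leP r t0; last first.
    by have := vpos t0; rewrite vE st0 t0r => /(_ isT); lra.
  apply: (lt_le_trans _ (observable_gronwall (C := 7 / 2) sg (ltW sr) _)).
    by rewrite mulr_gt0 ?expR_gt0// vE; lra.
  move=> q m /andP[sq qr] _ _ m1.
  have := vpos q; rewrite !vE (ltW sq) qr => /(_ isT) vq.
  rewrite m1; last lra.
  have := w_le q; rewrite (ltW sq) (ltW (lt_le_trans qr rt0)) => /(_ isT).
  by rewrite /observable; lra.
rewrite vE; lra.
Qed.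

(** As long as [u > 0] the solution slides, by the previous lemma, so [w = u]
    and [w' = (1 + m) * u <= 2 * w]: going back in time [u] decreases at most
    exponentially and never reaches the equilibrium. *)
Lemma sliding_backward (R : realType) (g : R -> R * R) (t0 s : R) :
  splitting_solution g -> (g t0).2 = 0 -> 1 / 2 < (g t0).1 < 2 / 3 ->
  s <= t0 -> 1 / 2 < (g s).1 /\ (g s).2 = 0.
Proof.
move=> sg y0 /andP[u0 u0_lt] st0.
have uE r : observable g 1 0 0 r = (g r).1 - 1 / 2 by rewrite /observable; ring.
have yE r : observable g 0 1 0 r = (g r).2 by rewrite /observable; ring.
have cobs p q : continuous (observable g p q 0) by exact: continuous_observable.
suff u_gt r : r <= t0 -> 1 / 2 < (g r).1.
  split; first exact: u_gt.
  apply: slides_while_right_of_equilibrium st0 _ => // r /andP[_].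
  exact: u_gt.
move=> rt0.
suff : 0 < observable g 1 0 0 (- - r) by rewrite opprK uE; lra.
(* Positivity is propagated backward by reversing time. *)
apply: (@positivity_persists _ (fun t => observable g 1 0 0 (- t)) (- t0));
  last lra.
- by move=> t; apply: continuous_comp; [exact: opp_continuous|exact: cobs].
- by rewrite opprK uE; lra.
move=> t t0t upos.
have {}upos q : - t < q -> q <= t0 -> 1 / 2 < (g q).1.
  move=> tq qt0; have := upos (- q); rewrite opprK uE.
  have -> : - t0 <= - q < t by apply/andP; split; lra.
  by move=> /(_ isT); lra.
have y_eq q : - t < q -> q <= t0 -> (g q).2 = 0.
  move=> tq qt0.
  apply: (slides_while_right_of_equilibrium sg y0 u0_lt qt0) => p /andP[qp pt0].
  by apply: upos pt0; exact: lt_le_trans qp.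
(* The sliding lemma applies after the time - t only; continuity gives y = 0 at
   that time. *)
have yt : (g (- t)).2 = 0.
  apply/eqP; apply: contraT => yneq0.
  have /nbhs_ballP[d /= d0 hd] : nbhs (- t) [set q | observable g 0 1 0 q != 0].
    by apply: (cvgr_neq0 _ (cobs 0 1 (- t))); rewrite yE.
  pose q := Num.min t0 (- t + d / 2).
  have : (g q).2 != 0.
    rewrite -yE; apply: hd; rewrite /ball/= ltr_norml /q.
    by case: (leP t0) => ?; apply/andP; split; lra.
  by rewrite y_eq ?eqxx// /q; case: (leP t0) => ?; lra.
have : observable g (- 1) (- (15 / 2)) 0 (- t) * expR (- (- 2) * (t0 - - t)) <=
    observable g (- 1) (- (15 / 2)) 0 t0.
  apply: observable_gronwall => //; first lra.
  move=> q m /andP[tq qt0] /andP[m0 m1] _ _.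
  have := upos q tq (ltW qt0); have := y_eq q tq (ltW qt0).
  by rewrite /observable => ->; nra.
rewrite uE /observable yt y0 => h.
have : 0 < ((g (- t)).1 - 1 / 2) * expR (- (- 2) * (t0 - - t)) by lra.
by rewrite pmulr_lgt0 ?expR_gt0.
Qed.

Lemma sliding_backward_decay (R : realType) (g : R -> R * R) (t0 s : R) :
  splitting_solution g -> (g t0).2 = 0 -> 1 / 2 < (g t0).1 < 2 / 3 -> s <= t0 ->
  (g s).1 - 1 / 2 <= ((g t0).1 - 1 / 2) * expR (- (t0 - s)).
Proof.
move=> sg y0 u0 st0.
have slide r : r <= t0 -> 1 / 2 < (g r).1 /\ (g r).2 = 0.
  exact: sliding_backward.
have : observable g 1 (15 / 2) 0 s * expR (t0 - s) <=
    observable g 1 (15 / 2) 0 t0.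
  by apply: below_gronwall => // r /andP[_ /ltW/slide[? ->]].
rewrite /observable y0 (slide s st0).2 expRN => h.
by rewrite ler_pdivlMr ?expR_gt0//; lra.
Qed.

(** * The homoclinic orbit *)

Lemma expRN_lt (R : realType) (K e x : R) :
  0 < e -> 0 <= K -> K / e < x -> K * expR (- x) < e.
Proof.
move=> e0 K0; rewrite ltr_pdivrMr// => hx.
rewrite expRN ltr_pdivrMr ?expR_gt0//.
apply: (lt_le_trans hx); rewrite mulrC ler_pM2l//.
by have := expR_ge1Dx x; lra.
Qed.

(** On the line the vertical component vanishes for [lambda = 4 - 6 * x], which
    lies in [0, 1] exactly for [1 / 2 <= x <= 2 / 3]. *)
Lemma sliding_interior_itv (R : realType) (z : R * R) :
  sliding_interior (4 / 5) (1 / 2) (- (1 / 15)) z ->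
  z.2 = 0 /\ 1 / 2 < z.1 < 2 / 3.
Proof.
move=> [-> /nbhs_ballP[d /= d0 hd]]; split => //.
have [lo hi] : (1 / 2 <= z.1 - d / 2) /\ (z.1 + d / 2 <= 2 / 3).
  have bounds w : sliding_region (4 / 5) (1 / 2) (- (1 / 15)) (w, 0) ->
      1 / 2 <= w <= 2 / 3.
    move=> [_ [lam /andP[l0 l1]]]; rewrite /pws_field/= => h.
    by apply/andP; split; lra.
  have in_ball w : `|z.1 - w| < d -> 1 / 2 <= w <= 2 / 3.
    by move=> ?; apply: bounds; exact: hd.
  split.
    suff /in_ball/andP[] : `|z.1 - (z.1 - d / 2)| < d by [].
    by rewrite opprB addrCA subrr addr0 ger0_norm; lra.
  suff /in_ball/andP[] : `|z.1 - (z.1 + d / 2)| < d by [].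
  by rewrite opprD addrA subrr sub0r normrN ger0_norm; lra.
by apply/andP; split; lra.
Qed.

Lemma dist_equilibrium_lt (R : realType) (z : R * R) (e : R) :
  `|z.1 - 1 / 2| < e -> `|z.2| < e -> `|(1 / 2, 0) - z| < e.
Proof.
by move=> h1 h2; rewrite prod_normE /= gt_max distrC h1 sub0r normrN.
Qed.

Theorem theorem5 (R : realType) (O : set (R * R)) :
  let alpha : R := 4 / 5 in
  let beta : R := 1 / 2 in
  let eps : R := - (1 / 15) in
  sliding_orbit alpha beta eps O ->
  homoclinic_orbit (filippov_field alpha beta eps) (1 / 2, 0) O.
Proof.
move=> alpha beta eps [g [sg [a [b [ab gslide]]] ->]].
have {}sg : splitting_solution g by [].
pose t0 := (a + b) / 2.
have /gslide/sliding_interior_itv[y0 u0] : a < t0 < b.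
  by rewrite /t0; apply/andP; split; lra.
have u0_gt : 1 / 2 < (g t0).1 by case/andP: u0.
exists g; split => //.
- exists (t0 - 1), t0 => gE.
  have := sliding_backward_decay sg y0 u0 (s := t0 - 1); rewrite gE.
  have -> : t0 - (t0 - 1) = 1 by ring.
  rewrite gerBl ler01 => /(_ isT); rewrite expRN.
  rewrite ler_pdivlMr ?expR_gt0// ger_pMr; last lra.
  by have := @expR_gt1 R 1; rewrite ltr01; lra.
- have [t1 t01 y1] := eventually_above sg u0_gt y0.
  have u1 := right_of_equilibrium_forward sg u0_gt t01.
  pose K := observable g (4 / 5) 1 0 t1.
  have K0 : 0 <= K by rewrite /K /observable; lra.
  apply/cvgrPdist_lt => e e0.
  have e2 : 0 < e / 2 by rewrite divr_gt0.
  exists (Num.max t1 (t1 + K / (e / 2))); split; first exact: num_real.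
  move=> t; rewrite gt_max => /andP[t1t tK].
  have u_gt := right_of_equilibrium_forward sg u1 (ltW t1t).
  have y_gt := above_forward sg u1 y1 (ltW t1t).
  have : K * expR (- (3 / 2 * (t - t1))) < e / 2 by apply: expRN_lt => //; lra.
  have := above_decay sg u1 y1 (ltW t1t); rewrite -/K /observable => h1 h2.
  by apply: dist_equilibrium_lt; rewrite ger0_norm; lra.
- pose K := (g t0).1 - 1 / 2.
  have K0 : 0 <= K by rewrite /K; lra.
  apply/cvgrPdist_lt => e e0.
  exists (Num.min t0 (t0 - K / e)); split; first exact: num_real.
  move=> t; rewrite lt_min => /andP[/ltW tt0 tK].
  have [u_gt yt] := sliding_backward sg y0 u0 tt0.
  have : K * expR (- (t0 - t)) < e by apply: expRN_lt => //; lra.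
  have := sliding_backward_decay sg y0 u0 tt0; rewrite -/K => h1 h2.
  by apply: dist_equilibrium_lt; rewrite ?yt ?normr0// ger0_norm; lra.
Qed.
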